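(* Let $A$ be a closed densely defined operator on a complex Hilbert space $\mathcal{H}$ with non-empty resolvent set $\rho(A)$. Let $z\in\rho(A)$. Assume there exists $\psi\in\mathcal{H}$ with $\|\psi\|=1$ and $\|R_A(z)\psi\|=\|R_A(z)\|$. Then the function $\zeta\mapsto\|R_A(\zeta)\|$ is not constant on any neighborhood of $z$ contained in $\rho(A)$. Moreover, there is a sequence $\{\psi_n\}_{n\in\mathbf{N}}$ in $\mathcal{H}$ with $\|\psi_n\|=1$ for all $n$ and $\lim_{n\to\infty}\|R_A(z)\psi_n\|=\|R_A(z)\|$, for which the limits $$\alpha=\lim_{n\to\infty}\langle R_A(z)\psi_n,R_A(z)^2\psi_n\rangle,\quad \beta=\lim_{n\to\infty}\|R_A(z)^2\psi_n\|^2,\quad \gamma=\lim_{n\to\infty}\langle R_A(z)\psi_n,R_A(z)^3\psi_n\rangle$$ exist, and such that one of the following holds: (i) $\alpha\neq0$, and for any $\theta\in(-\tfrac{\pi}{2},\tfrac{\pi}{2})$ there exist $C>0$ and $\varepsilon_0>0$ such that for every $z'\neq z$ with $|z'-z|\leq\varepsilon_0$ and $\arg(z'-z)=\theta-\arg\alpha$ we have $[z,z']\subset\rho(A)$ and $\|R_A(\zeta)\|\geq\|R_A(z)\|+C|\zeta-z|$ for all $\zeta\in[z,z']$; (ii) $\alpha=0$, $\gamma\neq0$, and for any $\theta\in(-\tfrac{\pi}{4},\tfrac{\pi}{4})\cup(\tfrac{3\pi}{4},\tfrac{5\pi}{4})$ there exist $C>0$ and $\varepsilon_0>0$ such that for every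 $z'\neq z$ with $|z'-z|\leq\varepsilon_0$ and $\arg(z'-z)=\theta-\tfrac12\arg\gamma$ we have $[z,z']\subset\rho(A)$ and $\|R_A(\zeta)\|\geq\|R_A(z)\|+C|\zeta-z|^2$ for all $\zeta\in[z,z']$; (iii) $\alpha=0$, $\gamma=0$, $\beta>0$, and there exist $C>0$ and $\varepsilon_0>0$ such that $\|R_A(\zeta)\|\geq\|R_A(z)\|+C|\zeta-z|^2$ for all $\zeta\in\rho(A)$ with $|\zeta-z|\leq\varepsilon_0$.
   Context: For $z\in\rho(A)$ the resolvent is the bounded operator $R_A(z)=(A-zI)^{-1}$ on $\mathcal{H}$, and $\|R_A(z)\|$ is its operator norm. The inner product $\langle\cdot,\cdot\rangle$ is conjugate-linear in the first argument and linear in the second. For $z,z'\in\mathbf{C}$, $[z,z']$ denotes the straight line segment from $z$ to $z'$. Equalities between arguments of non-zero complex numbers are understood modulo $2\pi$; $\arg$ of a non-zero complex number denotes any fixed choice of its argument. *)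

(* Defs.v *)
From Stdlib Require Import Reals ZArith.
From Coquelicot Require Import Coquelicot.

(** The norm is the one induced by the inner product, which is linear in the
    second argument, hence (by [inner_conj]) conjugate-linear in the first;
    positive definiteness follows from [inner_norm]. *)
Record HilbertSpace : Type := {
  hcarrier :> CompleteNormedModule C_AbsRing;
  inner : hcarrier -> hcarrier -> C;
  inner_plus_r : forall x y y' : hcarrier,
    inner x (plus y y') = Cplus (inner x y) (inner x y');
  inner_scal_r : forall (a : C) (x y : hcarrier),
    inner x (scal a y) = Cmult a (inner x y);
  inner_conj : forall x y : hcarrier, inner x y = Cconj (inner y x);
  inner_norm : forall x : hcarrier, inner x x = RtoC (norm x ^ 2)
}.

Arguments inner {h} _ _.

(** A linear operator defined on a linear subspace [dom]. The function [app]
    is total, but its values outside [dom] carry no meaning and are never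
    used below. *)
Record operator (H : HilbertSpace) : Type := {
  dom : H -> Prop;
  app : H -> H;
  dom_zero : dom zero;
  dom_plus : forall x y : H, dom x -> dom y -> dom (plus x y);
  dom_scal : forall (a : C) (x : H), dom x -> dom (scal a x);
  app_plus : forall x y : H,
    dom x -> dom y -> app (plus x y) = plus (app x) (app y);
  app_scal : forall (a : C) (x : H), dom x -> app (scal a x) = scal a (app x)
}.

Arguments dom {H} _ _.
Arguments app {H} _ _.

Definition closed_operator {H : HilbertSpace} (A : operator H) : Prop :=
  closed (fun p : H * H => dom A (fst p) /\ snd p = app A (fst p)).

Definition densely_defined {H : HilbertSpace} (A : operator H) : Prop :=
  forall (x : H) (U : H -> Prop), locally x U -> exists y : H, dom A y /\ U y.

Definition shift_eq {H : HilbertSpace} (A : operator H) (z : C) (y x : H)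
  : Prop :=
  dom A x /\ minus (app A x) (scal z x) = y.

(** [(A - z I)^{-1} y], meaningful when [A - z I] is a bijection from [dom A]
    onto the whole space: [iota] then selects the unique solution. *)
Definition resolvent {H : HilbertSpace} (A : operator H) (z : C) (y : H) : H :=
  iota (shift_eq A z y).

(** [is_linear] includes boundedness. *)
Definition resolvent_set {H : HilbertSpace} (A : operator H) (z : C) : Prop :=
  (forall y : H, exists! x : H, shift_eq A z y x) /\
  is_linear (resolvent A z).

(** Takes the junk value 0 when the supremum is infinite. *)
Definition op_norm {H : HilbertSpace} (T : H -> H) : R :=
  real (Lub_Rbar (fun r : R => exists x : H, norm x <= 1 /\ r = norm (T x))).

Definition segment (z z' w : C) : Prop :=
  exists t : R, 0 <= t <= 1 /\
    w = Cplus (Cmult (RtoC (1 - t)) z) (Cmult (RtoC t) z').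

Definition is_arg_choice (arg : C -> R) : Prop :=
  forall w : C, w <> RtoC 0 ->
    w = Cmult (RtoC (Cmod w)) (cos (arg w), sin (arg w)).

Definition eq_mod_2PI (s t : R) : Prop :=
  exists k : Z, s = t + IZR k * (2 * PI).

(* Main.v *)
Require Import Defs.
From Stdlib Require Import Reals ZArith Lra Lia Classical.
From Coquelicot Require Import Coquelicot.

(** Let [T] be the resolvent at [z], [M] its norm and [psi] a unit vector with
    [norm (T psi) = M]. The constant sequence [psi] is the required one, so
    the three limits are the values
      alpha = <T psi, T^2 psi>, beta = |T^2 psi|^2, gamma = <T psi, T^3 psi>.

    For [zeta = z + h] in the resolvent set, the vector
    [x = R(zeta) psi] is the solution of [x = T (psi + h x)]. As soon as
    [M |h| <= 1/2] this gives [|x| <= 2 M], and iterating the equation three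
    times yields the Taylor expansion of [x] in [h] with a controlled
    remainder, hence ([fixpoint_norm_sqr_ge])
      |R(z + h)|^2 >= |x|^2
        >= M^2 + 2 Re(h alpha) + |h|^2 beta + 2 Re(h^2 gamma) - 8 M^5 |h|^3.
    Because [psi] attains the norm, the constant term is exactly [M^2]; this
    is where the maximizer enters. Moreover [M > 0] and [beta > 0], since [T]
    is injective.

    Everything follows from this inequality. Averaged over [h = r, -r, ir,
    -ir] the terms in [alpha] and [gamma] cancel, and what is left,
    [M^2 + r^2 beta + O(r^3)], exceeds [M^2]: the norm is not constant. If
    [alpha <> 0], the linear term gives growth in the directions where
    [Re(h alpha)] is at least a positive multiple of [|h|]
    ([first_order_growth]). If [alpha = 0], the term [|h|^2 beta] gives
    quadratic growth in every direction where [Re(h^2 gamma)] is nonnegative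
    ([second_order_growth]): all directions when [gamma = 0], and otherwise
    in particular those where [cos (2 theta) > 0]. The statement about
    segments needs in addition that [z + h] is in the resolvent set when
    [M |h| <= 1/2], which is the Neumann series ([resolvent_set_near]). *)

Local Open Scope R_scope.

(** * Vector operations of a Hilbert space *)

Lemma minus_eq_iff {G : AbelianGroup} (u v w : G) :
  minus u v = w <-> u = plus w v.
Proof.
  assert (El : plus (opp v) v = zero) by apply plus_opp_l.
  assert (Er : plus v (opp v) = zero) by apply plus_opp_r.
  change (plus u (opp v) = w <-> u = plus w v). split.
  - intros <-. transitivity (plus u (plus (opp v) v)); [|apply plus_assoc].
    now rewrite El, plus_zero_r.
  - intros ->.
    transitivity (plus w (plus v (opp v))); [symmetry; apply plus_assoc|].
    now rewrite Er, plus_zero_r.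
Qed.

(* Each operation of [H] is reached through several structure projections that
   are convertible but not syntactically equal; these abbreviations fix one of
   them, so that rewriting finds its subterms. *)
Local Notation vadd :=
  (@plus (CompleteNormedModule.AbelianMonoid C_AbsRing (hcarrier _))).
Local Notation vzero :=
  (@zero (CompleteNormedModule.AbelianMonoid C_AbsRing (hcarrier _))).
Local Notation smul :=
  (@scal C_Ring (CompleteNormedModule.ModuleSpace C_AbsRing (hcarrier _))).
Local Notation vnorm :=
  (@norm C_AbsRing (CompleteNormedModule.NormedModule C_AbsRing (hcarrier _))).

Lemma vec_plus_zero_r {H : HilbertSpace} (u : H) : vadd u vzero = u.
Proof. exact (plus_zero_r u). Qed.

Lemma vec_plus_zero_l {H : HilbertSpace} (u : H) : vadd vzero u = u.
Proof. exact (plus_zero_l u). Qed.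

Lemma vec_plus_assoc {H : HilbertSpace} (u v w : H) :
  vadd u (vadd v w) = vadd (vadd u v) w.
Proof. exact (plus_assoc u v w). Qed.

Lemma vec_plus_comm {H : HilbertSpace} (u v : H) : vadd u v = vadd v u.
Proof. exact (plus_comm u v). Qed.

Lemma vec_scal_plus_r {H : HilbertSpace} (a : C) (u v : H) :
  smul a (vadd u v) = vadd (smul a u) (smul a v).
Proof. exact (scal_distr_l a u v). Qed.

Lemma vec_scal_plus_l {H : HilbertSpace} (a b : C) (u : H) :
  smul (Cplus a b) u = vadd (smul a u) (smul b u).
Proof. exact (scal_distr_r a b u). Qed.

Lemma vec_scal_assoc {H : HilbertSpace} (a b : C) (u : H) :
  smul a (smul b u) = smul (Cmult a b) u.
Proof. exact (scal_assoc a b u). Qed.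

Lemma vec_scal_1 {H : HilbertSpace} (u : H) : smul (RtoC 1) u = u.
Proof. exact (scal_one u). Qed.

Lemma vec_scal_0 {H : HilbertSpace} (u : H) : smul (RtoC 0) u = vzero.
Proof. exact (scal_zero_l u). Qed.

Lemma vec_scal_zero {H : HilbertSpace} (a : C) : smul a (vzero : H) = vzero.
Proof. exact (scal_zero_r a). Qed.

Lemma vec_norm_zero {H : HilbertSpace} : vnorm (vzero : H) = 0.
Proof. exact norm_zero. Qed.

Lemma vec_norm_eq_zero {H : HilbertSpace} (u : H) : vnorm u = 0 -> u = vzero.
Proof. exact (norm_eq_zero u). Qed.

Lemma vec_linear_plus {H : HilbertSpace} (T : H -> H) (u v : H) :
  is_linear T -> T (vadd u v) = vadd (T u) (T v).
Proof. intros HT. exact (linear_plus T HT u v). Qed.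

Lemma vec_linear_scal {H : HilbertSpace} (T : H -> H) (a : C) (u : H) :
  is_linear T -> T (smul a u) = smul a (T u).
Proof. intros HT. exact (linear_scal T HT a u). Qed.

(** * The real part of the inner product *)

Lemma Re_inner_sym {H : HilbertSpace} (u v : H) :
  Re (inner u v) = Re (inner v u).
Proof. rewrite (inner_conj H u v). reflexivity. Qed.

Lemma Re_inner_plus_r {H : HilbertSpace} (u v w : H) :
  Re (inner u (vadd v w)) = Re (inner u v) + Re (inner u w).
Proof. rewrite inner_plus_r. reflexivity. Qed.

Lemma Re_inner_plus_l {H : HilbertSpace} (u v w : H) :
  Re (inner (vadd u v) w) = Re (inner u w) + Re (inner v w).
Proof.
  rewrite Re_inner_sym, Re_inner_plus_r.
  now rewrite (Re_inner_sym w u), (Re_inner_sym w v).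
Qed.

Lemma Re_inner_self {H : HilbertSpace} (u : H) : Re (inner u u) = vnorm u ^ 2.
Proof. now rewrite inner_norm. Qed.

Lemma norm_plus_sqr {H : HilbertSpace} (u v : H) :
  vnorm (vadd u v) ^ 2 = vnorm u ^ 2 + 2 * Re (inner u v) + vnorm v ^ 2.
Proof.
  rewrite <- !Re_inner_self, Re_inner_plus_l, !Re_inner_plus_r.
  rewrite (Re_inner_sym v u). ring.
Qed.

Lemma norm_scal_sqr {H : HilbertSpace} (a : C) (u : H) :
  vnorm (smul a u) ^ 2 = Cmod a ^ 2 * vnorm u ^ 2.
Proof.
  rewrite <- Re_inner_self, inner_scal_r, inner_conj, inner_scal_r, inner_norm.
  rewrite Cmod2_alt. destruct a as [p q]. unfold Re, Im. simpl. ring.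
Qed.

Lemma norm_scal_C {H : HilbertSpace} (a : C) (u : H) :
  vnorm (smul a u) = Cmod a * vnorm u.
Proof.
  apply Rsqr_inj.
  - apply norm_ge_0.
  - apply Rmult_le_pos; [apply Cmod_ge_0 | apply norm_ge_0].
  - rewrite !Rsqr_pow2, Rpow_mult_distr. apply norm_scal_sqr.
Qed.

(** The Cauchy-Schwarz inequality for the real part: the norm is already
    known to satisfy the triangle inequality, and squaring that inequality
    leaves exactly the cross terms. *)
Lemma Re_inner_le {H : HilbertSpace} (u v : H) :
  Re (inner u v) <= vnorm u * vnorm v.
Proof.
  assert (Htri : vnorm (vadd u v) <= vnorm u + vnorm v)
    by exact (norm_triangle u v).
  assert (Hsq := norm_plus_sqr u v).
  assert (H0 := norm_ge_0 (vadd u v)).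
  nra.
Qed.

Lemma Re_inner_ge {H : HilbertSpace} (u v : H) :
  - (vnorm u * vnorm v) <= Re (inner u v).
Proof.
  assert (Hle := Re_inner_le u (smul (RtoC (-1)) v)).
  rewrite norm_scal_C, inner_scal_r, Cmod_R in Hle.
  rewrite Rabs_left in Hle by lra.
  destruct (inner u v) as [p q]. unfold Re in *. simpl in *. lra.
Qed.

(** * The operator norm *)

(** Boundedness makes the supremum finite, so that it is not replaced by the
    junk value. *)
Lemma norm_le_op_norm {H : HilbertSpace} (T : H -> H) (u : H) :
  is_linear T -> vnorm u <= 1 -> vnorm (T u) <= op_norm T.
Proof.
  intros [_ _ [B [B_pos HB]]] Hu.
  unfold op_norm.
  destruct (Lub_Rbar_correct
    (fun r : R => exists x : H, vnorm x <= 1 /\ r = vnorm (T x))) as [Hub Hlub].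
  set (l := Lub_Rbar _) in *.
  assert (Hle : Rbar_le (vnorm (T u)) l) by (apply Hub; exists u; auto).
  assert (HlB : Rbar_le l B).
  { apply Hlub. intros r [x [Hx ->]]. simpl.
    apply Rle_trans with (1 := HB x). nra. }
  destruct l; simpl in *; tauto.
Qed.

Lemma op_norm_bound {H : HilbertSpace} (T : H -> H) (u : H) :
  is_linear T -> vnorm (T u) <= op_norm T * vnorm u.
Proof.
  intros HT.
  destruct (Req_dec (vnorm u) 0) as [Hu|Hu].
  - destruct HT as [_ _ [B [_ HB]]]. generalize (HB u). rewrite Hu. lra.
  - assert (Hpos : 0 < vnorm u) by (generalize (norm_ge_0 u); lra).
    set (v := smul (RtoC (/ vnorm u)) u : H).
    assert (Hinv : 0 < / vnorm u) by now apply Rinv_0_lt_compat.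
    assert (Hv : vnorm v = 1).
    { unfold v. rewrite norm_scal_C, Cmod_R, Rabs_pos_eq; [|lra]. now field. }
    assert (Huv : u = smul (RtoC (vnorm u)) v).
    { unfold v. rewrite vec_scal_assoc.
      rewrite <- RtoC_mult, Rinv_r by assumption.
      now rewrite vec_scal_1. }
    rewrite Huv at 1. rewrite (vec_linear_scal _ _ _ HT), norm_scal_C, Cmod_R.
    rewrite Rabs_pos_eq by lra. rewrite Rmult_comm.
    apply Rmult_le_compat_r; [lra|]. apply norm_le_op_norm; [exact HT|lra].
Qed.

Lemma op_norm_ge_0 {H : HilbertSpace} (T : H -> H) :
  is_linear T -> 0 <= op_norm T.
Proof.
  intros HT. apply Rle_trans with (vnorm (T vzero)); [apply norm_ge_0|].
  apply norm_le_op_norm; [exact HT|].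
  rewrite vec_norm_zero. lra.
Qed.

(** * Resolvents as solutions of a fixed-point equation *)

Lemma resolvent_spec {H : HilbertSpace} (A : operator H) (z : C) (x y : H) :
  resolvent_set A z -> (shift_eq A z y x <-> x = resolvent A z y).
Proof.
  intros [Hex _].
  assert (HR : shift_eq A z y (resolvent A z y))
    by exact (iota_correct _ (Hex y)).
  split.
  - intros Hx. destruct (Hex y) as [x0 [_ Hu]].
    now rewrite <- (Hu x Hx), <- (Hu _ HR).
  - now intros ->.
Qed.

Lemma shift_eq_iff {H : HilbertSpace} (A : operator H) (z : C) (x y : H) :
  shift_eq A z y x <-> dom A x /\ app A x = vadd y (smul z x).
Proof.
  unfold shift_eq.
  assert (E := minus_eq_iff (app A x) (smul z x : H) y).
  split; intros [Hd He]; split; trivial; now apply E.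
Qed.

Lemma shift_eq_plus {H : HilbertSpace} (A : operator H) (z h : C) (x y : H) :
  shift_eq A (Cplus z h) y x <-> shift_eq A z (vadd y (smul h x)) x.
Proof.
  rewrite !shift_eq_iff, (Cplus_comm z h), vec_scal_plus_l, vec_plus_assoc.
  reflexivity.
Qed.

(** Solving [(A - (z + h)) x = y] amounts to [(A - z) x = y + h x]. The
    unbounded [A] is thus traded for the bounded operator [R(z)], and for
    small [h] the equation becomes a contraction. *)
Lemma shift_eq_fixpoint {H : HilbertSpace} (A : operator H) (z h : C)
  (x y : H) :
  resolvent_set A z ->
  (shift_eq A (Cplus z h) y x <->
   x = resolvent A z (vadd y (smul h x))).
Proof. intros Hz. rewrite shift_eq_plus. now apply resolvent_spec. Qed.

Lemma resolvent_inj {H : HilbertSpace} (A : operator H) (z : C) (y : H) :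
  resolvent_set A z -> resolvent A z y = vzero -> y = vzero.
Proof.
  intros Hz Hy.
  assert (Hs : shift_eq A z y vzero) by (apply resolvent_spec; auto).
  apply shift_eq_iff in Hs. destruct Hs as [_ Hs].
  assert (E : app A vzero = vzero).
  { rewrite <- (vec_scal_0 vzero) at 1.
    rewrite app_scal by apply dom_zero. apply vec_scal_0. }
  rewrite E, vec_scal_zero, vec_plus_zero_r in Hs. now symmetry.
Qed.

(** * Solving the fixed-point equation for small shifts *)

(** The term [T (h x)] has norm at most [|x| / 2] and is absorbed on the
    left. *)
Lemma fixpoint_norm_le {H : HilbertSpace} (T : H -> H) (h : C) (x y : H) :
  is_linear T -> op_norm T * Cmod h <= 1 / 2 ->
  x = T (vadd y (smul h x)) -> vnorm x <= 2 * op_norm T * vnorm y.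
Proof.
  intros HT Hh Hx.
  assert (H1 := op_norm_bound T (vadd y (smul h x)) HT).
  rewrite <- Hx in H1.
  assert (H2 : vnorm (vadd y (smul h x)) <= vnorm y + Cmod h * vnorm x).
  { rewrite <- norm_scal_C. exact (norm_triangle y (smul h x)). }
  assert (HM := op_norm_ge_0 T HT).
  assert (H3 := norm_ge_0 x).
  nra.
Qed.

Lemma fixpoint_unique {H : HilbertSpace} (T : H -> H) (h : C) (x x' y : H) :
  is_linear T -> op_norm T * Cmod h <= 1 / 2 ->
  x = T (vadd y (smul h x)) -> x' = T (vadd y (smul h x')) -> x = x'.
Proof.
  intros HT Hh Hx Hx'.
  (* The difference x - x' solves the same equation with y = 0. *)
  set (d := vadd x (smul (RtoC (-1)) x') : H).
  assert (Hxd : x = vadd x' d).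
  { unfold d. rewrite <- (vec_scal_1 x') at 1.
    rewrite (vec_plus_comm x), vec_plus_assoc, <- vec_scal_plus_l.
    replace (Cplus 1 (-1)) with (RtoC 0)
      by (unfold RtoC, Cplus; simpl; f_equal; ring).
    now rewrite vec_scal_0, vec_plus_zero_l. }
  assert (Hd : d = T (vadd vzero (smul h d))).
  { assert (E : vadd x' d = vadd x' (T (vadd vzero (smul h d)))).
    { rewrite <- Hxd. rewrite Hx at 1. rewrite Hx' at 1.
      rewrite <- (vec_linear_plus _ _ _ HT). f_equal.
      rewrite vec_plus_zero_l, <- vec_plus_assoc, <- vec_scal_plus_r.
      now rewrite <- Hxd. }
    exact (plus_reg_l x' _ _ E). }
  assert (Hn := fixpoint_norm_le T h _ _ HT Hh Hd).
  rewrite vec_norm_zero, Rmult_0_r in Hn.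
  assert (Hz : d = vzero).
  { apply vec_norm_eq_zero. assert (H0 := norm_ge_0 d). lra. }
  now rewrite Hxd, Hz, vec_plus_zero_r.
Qed.

(** The terms [h^n T^(n+1) y] of the Neumann series of the fixed point. *)
Fixpoint neumann_term {H : HilbertSpace} (T : H -> H) (h : C) (y : H)
  (n : nat) : H :=
  match n with
  | O => T y
  | S n' => T (smul h (neumann_term T h y n'))
  end.

Lemma neumann_term_le {H : HilbertSpace} (T : H -> H) (h : C) (y : H)
  (n : nat) :
  is_linear T -> op_norm T * Cmod h <= 1 / 2 ->
  vnorm (neumann_term T h y n) <= vnorm (T y) * (1 / 2) ^ n.
Proof.
  intros HT Hh. induction n as [|n IH]; simpl; [lra|].
  apply Rle_trans with (1 := op_norm_bound T _ HT).
  rewrite norm_scal_C.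
  assert (H0 := norm_ge_0 (neumann_term T h y n)).
  nra.
Qed.

(** The partial sums are the Picard iterates of the fixed-point equation, so
    their limit solves it by continuity. *)
Lemma neumann_sum_S {H : HilbertSpace} (T : H -> H) (h : C) (y : H)
  (n : nat) :
  is_linear T ->
  sum_n (neumann_term T h y) (S n)
  = T (vadd y (smul h (sum_n (neumann_term T h y) n))).
Proof.
  intros HT.
  set (a := neumann_term T h y).
  assert (Ha : forall k, a (S k) = T (smul h (a k))) by reflexivity.
  assert (Hsum : forall k, sum_n a (S k) = vadd (sum_n a k) (a (S k)))
    by exact (sum_Sn a).
  assert (H0 : sum_n a 0 = T y) by exact (sum_O a).
  assert (H1 : a O = T y) by reflexivity.
  clearbody a.
  induction n as [|n IH]; rewrite Hsum.
  - now rewrite H0, Ha, H1, (vec_linear_plus _ _ _ HT).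
  - rewrite IH at 1. rewrite Hsum, Ha, <- (vec_linear_plus _ _ _ HT).
    now rewrite <- vec_plus_assoc, <- vec_scal_plus_r.
Qed.

Lemma fixpoint_exists {H : HilbertSpace} (T : H -> H) (h : C) (y : H) :
  is_linear T -> op_norm T * Cmod h <= 1 / 2 ->
  exists x : H, x = T (vadd y (smul h x)).
Proof.
  intros HT Hh.
  assert (Hs : ex_series (neumann_term T h y)).
  { apply ex_series_le with (b := fun n => vnorm (T y) * (1 / 2) ^ n).
    - intros n. now apply neumann_term_le.
    - apply (ex_series_scal_l (V := R_NormedModule) (vnorm (T y) : R_AbsRing)
        (fun n => (1 / 2) ^ n)).
      apply ex_series_geom.
      rewrite Rabs_pos_eq; lra. }
  destruct Hs as [x Hx]. exists x.
  assert (Hrec := fun n => neumann_sum_S T h y n HT).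
  set (s := sum_n (neumann_term T h y)) in *.
  assert (Hlim : filterlim s eventually (locally (x : H))) by exact Hx.
  assert (Hs : forall n, s (S n) = T (vadd y (smul h (s n)))) by exact Hrec.
  clearbody s. clear Hrec Hx.
  assert (Hshift : filterlim (fun n => s (S n)) eventually (locally (x : H))).
  { apply (filterlim_comp _ _ _ S s eventually eventually _); [|exact Hlim].
    apply eventually_subseq. intros n. lia. }
  assert (Hcont : continuous (fun v : H => T (vadd y (smul h v))) x).
  { apply (continuous_comp (fun v : H => vadd y (smul h v)) T).
    - exact (continuous_plus (V := H) (fun _ => y) (fun v => smul h v) x
        (continuous_const (V := H) y x)
        (continuous_scal_r (V := H) h (fun v => v) x (continuous_id x))).
    - exact (linear_cont T _ HT). }
  assert (Hstep : filterlim (fun n => s (S n)) eventually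
                    (locally (T (vadd y (smul h x))))).
  { apply filterlim_ext with (fun n => T (vadd y (smul h (s n)))).
    - intros n. symmetry. apply Hs.
    - exact (filterlim_comp _ _ _ s (fun v => T (vadd y (smul h v)))
        _ _ _ Hlim Hcont). }
  exact (filterlim_locally_unique (V := H) _ _ _ Hshift Hstep).
Qed.

(** Linearity and boundedness of [R(z + h)] are read off the fixed-point
    equation through uniqueness and the norm bound of its solutions. *)
Lemma resolvent_set_near {H : HilbertSpace} (A : operator H) (z h : C) :
  resolvent_set A z -> op_norm (resolvent A z) * Cmod h <= 1 / 2 ->
  resolvent_set A (Cplus z h).
Proof.
  intros Hz Hh.
  assert (HT : is_linear (resolvent A z)) by apply Hz.
  assert (Hex : forall y : H, exists! x : H, shift_eq A (Cplus z h) y x).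
  { intros y. destruct (fixpoint_exists _ h y HT Hh) as [x Hx].
    exists x. split.
    - now apply shift_eq_fixpoint.
    - intros x' Hx'. apply (shift_eq_fixpoint A z h x' y Hz) in Hx'.
      exact (fixpoint_unique _ h x x' y HT Hh Hx Hx'). }
  assert (HS : forall y : H, resolvent A (Cplus z h) y =
     resolvent A z (vadd y (smul h (resolvent A (Cplus z h) y)))).
  { intros y. apply (shift_eq_fixpoint A z h _ y Hz).
    exact (iota_correct _ (Hex y)). }
  set (S := resolvent A (Cplus z h)) in *.
  set (T := resolvent A z) in *.
  assert (Hplus : forall u v : H, S (vadd u v) = vadd (S u) (S v)).
  { intros u v.
    apply (fixpoint_unique T h _ _ (vadd u v) HT Hh); [apply HS|].
    rewrite (HS u) at 1. rewrite (HS v) at 1.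
    rewrite <- (vec_linear_plus _ _ _ HT). f_equal.
    rewrite vec_scal_plus_r, <- !vec_plus_assoc. f_equal.
    rewrite !vec_plus_assoc. f_equal. apply vec_plus_comm. }
  assert (Hscal : forall (a : C) (u : H), S (smul a u) = smul a (S u)).
  { intros a u.
    apply (fixpoint_unique T h _ _ (smul a u) HT Hh); [apply HS|].
    rewrite (HS u) at 1. rewrite <- (vec_linear_scal _ _ _ HT). f_equal.
    rewrite vec_scal_plus_r, !vec_scal_assoc. now rewrite (Cmult_comm a h). }
  split; [exact Hex|split; [exact Hplus|exact Hscal|]].
  exists (2 * op_norm T + 1).
  assert (HM := op_norm_ge_0 T HT). split; [lra|].
  intros y. assert (Hn := fixpoint_norm_le T h _ y HT Hh (HS y)).
  apply Rle_trans with (1 := Hn).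
  apply Rmult_le_compat_r; [apply norm_ge_0|lra].
Qed.

(** * Expansion of the resolvent norm to second order *)

Lemma fixpoint_unfold {H : HilbertSpace} (T : H -> H) (h : C) (x y : H) :
  is_linear T -> x = T (vadd y (smul h x)) ->
  x = vadd (T y) (smul h (T x)).
Proof.
  intros HT Hx. rewrite Hx at 1.
  now rewrite (vec_linear_plus _ _ _ HT), (vec_linear_scal _ _ _ HT).
Qed.

Lemma fixpoint_expansion {H : HilbertSpace} (T : H -> H) (h : C) (x y : H) :
  is_linear T -> x = T (vadd y (smul h x)) ->
  x = vadd (T y) (vadd (smul h (T (T y))) (smul (Cmult h h) (T (T x)))).
Proof.
  intros HT Hx.
  assert (E := fixpoint_unfold T h x y HT Hx).
  rewrite E at 1. f_equal. rewrite E at 1.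
  rewrite (vec_linear_plus _ _ _ HT), (vec_linear_scal _ _ _ HT).
  now rewrite vec_scal_plus_r, vec_scal_assoc.
Qed.

(** Write [x = T psi + (h T^2 psi + h^2 T^2 x)]. The square of the norm of the
    bracket gives the term [|h|^2 |T^2 psi|^2], the cross term with [T psi]
    gives the two real parts once [T^2 x] is replaced by
    [T^3 psi + h T^3 x]. The two remaining inner products have a factor
    [|h|^3] and are each at most [2 M^5 |h|^3], which doubled and added make
    the constant 8. *)
Lemma fixpoint_norm_sqr_ge {H : HilbertSpace} (T : H -> H) (h : C) (x psi : H) :
  is_linear T -> vnorm psi = 1 -> op_norm T * Cmod h <= 1 / 2 ->
  x = T (vadd psi (smul h x)) ->
  vnorm x ^ 2 >=
    vnorm (T psi) ^ 2
    + 2 * Re (Cmult h (inner (T psi) (T (T psi))))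
    + Cmod h ^ 2 * vnorm (T (T psi)) ^ 2
    + 2 * Re (Cmult (Cmult h h) (inner (T psi) (T (T (T psi)))))
    - 8 * op_norm T ^ 5 * Cmod h ^ 3.
Proof.
  intros HT Hpsi Hh Hx.
  set (M := op_norm T) in *. set (r := Cmod h) in *.
  assert (HM : 0 <= M) by now apply op_norm_ge_0.
  assert (Hr : 0 <= r) by apply Cmod_ge_0.
  assert (HB : forall u, vnorm (T u) <= M * vnorm u)
    by (intros u; now apply op_norm_bound).
  assert (Hxn : vnorm x <= 2 * M).
  { assert (Hn := fixpoint_norm_le T h x psi HT Hh Hx).
    fold M in Hn. rewrite Hpsi in Hn. lra. }
  assert (H1 : vnorm (T psi) <= M) by (generalize (HB psi); rewrite Hpsi; lra).
  assert (H2 : vnorm (T (T psi)) <= M ^ 2) by (generalize (HB (T psi)); nra).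
  assert (H3 : vnorm (T x) <= 2 * M ^ 2) by (generalize (HB x); nra).
  assert (H4 : vnorm (T (T x)) <= 2 * M ^ 3) by (generalize (HB (T x)); nra).
  assert (H5 : vnorm (T (T (T x))) <= 2 * M ^ 4)
    by (generalize (HB (T (T x))); nra).
  assert (E3 : T (T x) = vadd (T (T (T psi))) (smul h (T (T (T x))))).
  { assert (E := fixpoint_unfold T h x psi HT Hx).
    rewrite E at 1.
    now rewrite !(vec_linear_plus _ _ _ HT), !(vec_linear_scal _ _ _ HT). }
  assert (EX := fixpoint_expansion T h x psi HT Hx).
  rewrite EX, norm_plus_sqr, Re_inner_plus_r, (norm_plus_sqr (smul h _)).
  rewrite norm_scal_sqr. fold r.
  assert (Hcross : Re (inner (smul h (T (T psi))) (smul (Cmult h h) (T (T x))))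
                   >= - (2 * M ^ 5 * r ^ 3)).
  { apply Rle_ge. eapply Rle_trans; [|apply Re_inner_ge].
    rewrite !norm_scal_C, Cmod_mult. fold r.
    apply Ropp_le_contravar.
    assert (Hp : vnorm (T (T psi)) * vnorm (T (T x)) <= M ^ 2 * (2 * M ^ 3))
      by (apply Rmult_le_compat; auto using norm_ge_0).
    assert (Hr3 : 0 <= r ^ 3) by now apply pow_le.
    nra. }
  assert (Htail : Re (inner (T psi) (smul (Cmult h h) (T (T x)))) >=
    Re (Cmult (Cmult h h) (inner (T psi) (T (T (T psi))))) - 2 * M ^ 5 * r ^ 3).
  { rewrite E3, vec_scal_plus_r, Re_inner_plus_r, inner_scal_r, vec_scal_assoc.
    assert (Hlow := Re_inner_ge (T psi)
                      (smul (Cmult (Cmult h h) h) (T (T (T x))))).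
    rewrite norm_scal_C, !Cmod_mult in Hlow. fold r in Hlow.
    assert (Hp : vnorm (T psi) * vnorm (T (T (T x))) <= M * (2 * M ^ 4))
      by (apply Rmult_le_compat; auto using norm_ge_0).
    assert (Hr3 : 0 <= r ^ 3) by now apply pow_le.
    nra. }
  rewrite inner_scal_r.
  assert (Hsq := pow2_ge_0 (vnorm (smul (Cmult h h) (T (T x))))).
  nra.
Qed.

Lemma resolvent_norm_sqr_ge {H : HilbertSpace} (A : operator H) (z h : C)
  (psi : H) :
  let T := resolvent A z in
  resolvent_set A z -> resolvent_set A (Cplus z h) ->
  vnorm psi = 1 -> vnorm (T psi) = op_norm T ->
  op_norm T * Cmod h <= 1 / 2 ->
  op_norm (resolvent A (Cplus z h)) ^ 2 >=
    op_norm T ^ 2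
    + 2 * Re (Cmult h (inner (T psi) (T (T psi))))
    + Cmod h ^ 2 * vnorm (T (T psi)) ^ 2
    + 2 * Re (Cmult (Cmult h h) (inner (T psi) (T (T (T psi)))))
    - 8 * op_norm T ^ 5 * Cmod h ^ 3.
Proof.
  intros T Hz Hzh Hpsi Hmax Hh.
  assert (HT : is_linear T) by apply Hz.
  assert (HS : is_linear (resolvent A (Cplus z h))) by apply Hzh.
  set (x := resolvent A (Cplus z h) psi).
  assert (Hx : x = T (vadd psi (smul h x))).
  { apply (shift_eq_fixpoint A z h x psi Hz).
    now apply (resolvent_spec A (Cplus z h) x psi Hzh). }
  assert (Hexp := fixpoint_norm_sqr_ge T h x psi HT Hpsi Hh Hx).
  rewrite Hmax in Hexp.
  assert (Hle : vnorm x <= op_norm (resolvent A (Cplus z h))).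
  { apply norm_le_op_norm; [exact HS|]. apply Req_le, Hpsi. }
  assert (Hsq : vnorm x ^ 2 <= op_norm (resolvent A (Cplus z h)) ^ 2)
    by (apply pow_incr; split; [apply norm_ge_0 | exact Hle]).
  lra.
Qed.

Lemma op_norm_resolvent_pos {H : HilbertSpace} (A : operator H) (z : C)
  (psi : H) :
  resolvent_set A z -> vnorm psi = 1 ->
  vnorm (resolvent A z psi) = op_norm (resolvent A z) ->
  0 < op_norm (resolvent A z).
Proof.
  intros Hz Hpsi Hmax.
  destruct (Rle_lt_or_eq_dec 0 (op_norm (resolvent A z))) as [Hlt|Heq];
    [apply op_norm_ge_0, Hz | exact Hlt |].
  exfalso. rewrite <- Heq in Hmax.
  apply vec_norm_eq_zero in Hmax. apply (resolvent_inj A z psi Hz) in Hmax.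
  rewrite Hmax, vec_norm_zero in Hpsi. lra.
Qed.

Lemma resolvent_sqr_pos {H : HilbertSpace} (A : operator H) (z : C)
  (psi : H) :
  resolvent_set A z -> vnorm psi = 1 ->
  0 < vnorm (resolvent A z (resolvent A z psi)).
Proof.
  intros Hz Hpsi.
  destruct (Rle_lt_or_eq_dec 0 (vnorm (resolvent A z (resolvent A z psi))))
    as [Hlt|Heq]; [apply norm_ge_0 | exact Hlt |].
  exfalso. symmetry in Heq. apply vec_norm_eq_zero in Heq.
  apply (resolvent_inj A z _ Hz), (resolvent_inj A z _ Hz) in Heq.
  rewrite Heq, vec_norm_zero in Hpsi. lra.
Qed.

(** * Growth in favourable directions *)

Lemma exists_small (b D : R) :
  0 < b -> 0 <= D -> exists eps, 0 < eps <= 1 /\ eps * D <= b.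
Proof.
  intros Hb HD. exists (Rmin 1 (b / (1 + D))).
  assert (Hq : 0 < b / (1 + D)) by (apply Rdiv_lt_0_compat; lra).
  assert (E : b / (1 + D) * (1 + D) = b) by (field; lra).
  assert (H1 := Rmin_l 1 (b / (1 + D))).
  assert (H2 := Rmin_r 1 (b / (1 + D))).
  assert (H0 : 0 < Rmin 1 (b / (1 + D))) by (apply Rmin_glb_lt; lra).
  split; [lra|]. nra.
Qed.

(** Passage from squares to norms. With [t = s / (3 M)] the bound
    [s <= M^2] gives [3 t <= M], so
    [(M + t)^2 = M^2 + 2 M t + t^2 <= M^2 + 3 M t = M^2 + s]. *)
Lemma lower_bound_of_sqr (M N s : R) :
  0 < M -> 0 <= N -> 0 <= s <= M ^ 2 -> M ^ 2 + s <= N ^ 2 ->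
  N >= M + / (3 * M) * s.
Proof.
  intros HM HN Hs Hsq.
  set (t := / (3 * M) * s).
  assert (E : s = 3 * M * t) by (unfold t; field; lra).
  assert (Ht : 0 <= t).
  { apply Rmult_le_pos; [|lra]. left. apply Rinv_0_lt_compat. lra. }
  rewrite E in Hs, Hsq.
  assert (HtM : 3 * t <= M) by nra.
  apply Rle_ge, Rnot_lt_le. intros Hlt. nra.
Qed.

Lemma Re_sqr_mult_ge (h w : C) :
  Re (Cmult (Cmult h h) w) >= - (Cmod h ^ 2 * Cmod w).
Proof.
  assert (Hre := re_le_Cmod (Cmult (Cmult h h) w)).
  rewrite !Cmod_mult in Hre. apply Rabs_le_between in Hre. nra.
Qed.

(** Of the gain [2 a |h|] in the square of the norm, one half pays for the
    [gamma] term and the cubic remainder when [h] is small; the other half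
    is the growth. *)
Lemma first_order_growth {H : HilbertSpace} (A : operator H) (z : C)
  (psi : H) (a : R) :
  let T := resolvent A z in
  resolvent_set A z -> vnorm psi = 1 -> vnorm (T psi) = op_norm T -> 0 < a ->
  exists c eps : R, 0 < c /\ 0 < eps /\ eps * op_norm T <= 1 / 2 /\
    forall h : C, Cmod h <= eps ->
      a * Cmod h <= Re (Cmult h (inner (T psi) (T (T psi)))) ->
      op_norm (resolvent A (Cplus z h)) >= op_norm T + c * Cmod h.
Proof.
  intros T Hz Hpsi Hmax Ha.
  assert (HM : 0 < op_norm T) by now apply (op_norm_resolvent_pos A z psi).
  set (M := op_norm T) in *.
  set (gamma := inner (T psi) (T (T (T psi)))).
  set (D := 2 * Cmod gamma + 8 * M ^ 5).
  assert (HG := Cmod_ge_0 gamma).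
  assert (HM5 : 0 < M ^ 5) by now apply pow_lt.
  assert (HM2 : 0 < M ^ 2) by now apply pow_lt.
  destruct (exists_small (Rmin (1 / 2) (Rmin a (M ^ 2))) (M + D + a))
    as [eps [Heps HD]].
  { repeat apply Rmin_glb_lt; lra. }
  { unfold D. lra. }
  assert (Hm1 := Rmin_l (1 / 2) (Rmin a (M ^ 2))).
  assert (Hm2 := Rmin_r (1 / 2) (Rmin a (M ^ 2))).
  assert (Hm3 := Rmin_l a (M ^ 2)).
  assert (Hm4 := Rmin_r a (M ^ 2)).
  assert (HD0 : 0 <= D) by (unfold D; lra).
  assert (HeM : eps * M <= 1 / 2) by nra.
  assert (HeD : eps * D <= a) by nra.
  assert (Hea : eps * a <= M ^ 2) by nra.
  exists (/ (3 * M) * a), eps.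
  split; [apply Rmult_lt_0_compat; [apply Rinv_0_lt_compat; lra|lra]|].
  split; [lra|]. split; [exact HeM|].
  intros h Hh Hre.
  assert (Hr := Cmod_ge_0 h).
  assert (HhM : M * Cmod h <= 1 / 2) by nra.
  assert (Hzh : resolvent_set A (Cplus z h)) by now apply resolvent_set_near.
  assert (Hexp := resolvent_norm_sqr_ge A z h psi Hz Hzh Hpsi Hmax HhM).
  cbv zeta in Hexp. change (resolvent A z) with T in Hexp.
  fold M gamma in Hexp.
  assert (Hg := Re_sqr_mult_ge h gamma).
  assert (Hb : 0 <= Cmod h ^ 2 * vnorm (T (T psi)) ^ 2)
    by (rewrite <- Rpow_mult_distr; apply pow2_ge_0).
  set (r := Cmod h) in *.
  rewrite Rmult_assoc. apply lower_bound_of_sqr; [exact HM| |nra|].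
  { apply op_norm_ge_0, Hzh. }
  assert (Hrest : 2 * (r ^ 2 * Cmod gamma) + 8 * M ^ 5 * r ^ 3 <= a * r).
  { apply Rle_trans with (r * (r * D)); [unfold D|].
    - assert (r ^ 3 <= r ^ 2) by (simpl; nra). nra.
    - assert (r * D <= a) by nra. nra. }
  lra.
Qed.

(** Half of [|h|^2 |T^2 psi|^2] pays for the cubic remainder; the factor
    [|T^2 psi|^2] is positive since [T] is injective. *)
Lemma second_order_growth {H : HilbertSpace} (A : operator H) (z : C)
  (psi : H) :
  let T := resolvent A z in
  resolvent_set A z -> vnorm psi = 1 -> vnorm (T psi) = op_norm T ->
  inner (T psi) (T (T psi)) = RtoC 0 ->
  exists c eps : R, 0 < c /\ 0 < eps /\ eps * op_norm T <= 1 / 2 /\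
    forall h : C, Cmod h <= eps ->
      0 <= Re (Cmult (Cmult h h) (inner (T psi) (T (T (T psi))))) ->
      op_norm (resolvent A (Cplus z h)) >= op_norm T + c * Cmod h ^ 2.
Proof.
  intros T Hz Hpsi Hmax Halpha.
  assert (HM : 0 < op_norm T) by now apply (op_norm_resolvent_pos A z psi).
  assert (Hbeta : 0 < vnorm (T (T psi)) ^ 2)
    by now apply pow_lt, resolvent_sqr_pos.
  set (M := op_norm T) in *.
  set (beta := vnorm (T (T psi)) ^ 2) in *.
  assert (HM5 : 0 < M ^ 5) by now apply pow_lt.
  assert (HM2 : 0 < M ^ 2) by now apply pow_lt.
  destruct (exists_small (Rmin (1 / 2) (Rmin (beta / 2) (M ^ 2)))
    (M + 8 * M ^ 5 + beta / 2)) as [eps [Heps HD]].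
  { repeat apply Rmin_glb_lt; lra. }
  { lra. }
  assert (Hm1 := Rmin_l (1 / 2) (Rmin (beta / 2) (M ^ 2))).
  assert (Hm2 := Rmin_r (1 / 2) (Rmin (beta / 2) (M ^ 2))).
  assert (Hm3 := Rmin_l (beta / 2) (M ^ 2)).
  assert (Hm4 := Rmin_r (beta / 2) (M ^ 2)).
  assert (HeM : eps * M <= 1 / 2) by nra.
  assert (HeK : eps * (8 * M ^ 5) <= beta / 2) by nra.
  assert (Heb : eps * (beta / 2) <= M ^ 2) by nra.
  exists (/ (3 * M) * (beta / 2)), eps.
  split; [apply Rmult_lt_0_compat; [apply Rinv_0_lt_compat; lra|lra]|].
  split; [lra|]. split; [exact HeM|].
  intros h Hh Hre.
  assert (Hr := Cmod_ge_0 h).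
  assert (HhM : M * Cmod h <= 1 / 2) by nra.
  assert (Hzh : resolvent_set A (Cplus z h)) by now apply resolvent_set_near.
  assert (Hexp := resolvent_norm_sqr_ge A z h psi Hz Hzh Hpsi Hmax HhM).
  cbv zeta in Hexp. change (resolvent A z) with T in Hexp.
  rewrite Halpha, Cmult_0_r in Hexp.
  fold M beta in Hexp. change (Re (RtoC 0)) with 0 in Hexp.
  set (r := Cmod h) in *.
  assert (Hr2 : r ^ 2 <= r) by (simpl; nra).
  rewrite Rmult_assoc. apply lower_bound_of_sqr; [exact HM| |nra|].
  { apply op_norm_ge_0, Hzh. }
  assert (Hrest : 8 * M ^ 5 * r ^ 3 <= beta / 2 * r ^ 2).
  { replace (8 * M ^ 5 * r ^ 3) with (8 * M ^ 5 * r * r ^ 2) by ring.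
    apply Rmult_le_compat_r; [apply pow2_ge_0|nra]. }
  lra.
Qed.

(** On a circle of radius [r] the four points [r], [-r], [ir], [-ir] have zero
    sum, and so have their squares. Adding the four expansions therefore
    leaves only [r^2 beta <= 8 M^5 r^3], false for small [r]. *)
Lemma resolvent_norm_not_constant {H : HilbertSpace} (A : operator H) (z : C)
  (psi : H) (U : C -> Prop) :
  resolvent_set A z -> vnorm psi = 1 ->
  vnorm (resolvent A z psi) = op_norm (resolvent A z) ->
  locally z U -> (forall zeta : C, U zeta -> resolvent_set A zeta) ->
  ~ (exists c : R, forall zeta : C, U zeta -> op_norm (resolvent A zeta) = c).
Proof.
  intros Hz Hpsi Hmax HU HUrho [c Hc].
  assert (HM := op_norm_resolvent_pos A z psi Hz Hpsi Hmax).
  assert (Hbeta : 0 < vnorm (resolvent A z (resolvent A z psi)) ^ 2)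
    by now apply pow_lt, resolvent_sqr_pos.
  assert (Hcz : op_norm (resolvent A z) = c)
    by (apply Hc; exact (locally_singleton z U HU)).
  set (T := resolvent A z) in *. set (M := op_norm T) in *.
  set (beta := vnorm (T (T psi)) ^ 2) in *.
  set (alpha := inner (T psi) (T (T psi))).
  set (gamma := inner (T psi) (T (T (T psi)))).
  assert (HM5 : 0 < M ^ 5) by now apply pow_lt.
  destruct HU as [[d Hd] HU].
  destruct (exists_small (Rmin (1 / 2) (Rmin (beta / 2) (d / 2)))
    (M + 8 * M ^ 5 + 1)) as [r [Hr HD]].
  { repeat apply Rmin_glb_lt; lra. }
  { lra. }
  assert (Hm1 := Rmin_l (1 / 2) (Rmin (beta / 2) (d / 2))).
  assert (Hm2 := Rmin_r (1 / 2) (Rmin (beta / 2) (d / 2))).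
  assert (Hm3 := Rmin_l (beta / 2) (d / 2)).
  assert (Hm4 := Rmin_r (beta / 2) (d / 2)).
  assert (HrM : M * r <= 1 / 2) by nra.
  assert (HrK : 8 * M ^ 5 * r <= beta / 2) by nra.
  assert (Hrd : r < d) by nra.
  assert (Hexp : forall p q : R, p ^ 2 + q ^ 2 = r ^ 2 ->
    2 * Re (Cmult (p, q) alpha) + r ^ 2 * beta
    + 2 * Re (Cmult (Cmult (p, q) (p, q)) gamma) - 8 * M ^ 5 * r ^ 3 <= 0).
  { intros p q Hpq.
    assert (Hmod : Cmod (p, q) = r).
    { unfold Cmod. simpl fst. simpl snd. rewrite Hpq. apply sqrt_pow2. lra. }
    assert (HUpq : U (Cplus z (p, q))).
    { apply HU. split.
      - change (Rabs (Rminus (fst z + p) (fst z)) < d).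
        apply Rabs_def1; nra.
      - change (Rabs (Rminus (snd z + q) (snd z)) < d).
        apply Rabs_def1; nra. }
    assert (HhM : M * Cmod (p, q) <= 1 / 2) by now rewrite Hmod.
    assert (He := resolvent_norm_sqr_ge A z (p, q) psi Hz (HUrho _ HUpq)
                    Hpsi Hmax HhM).
    rewrite (Hc _ HUpq), Hmod in He.
    cbv zeta in He. change (resolvent A z) with T in He.
    fold M beta alpha gamma in He.
    rewrite Hcz in He. rewrite Hcz. lra. }
  assert (E1 := Hexp r 0 ltac:(ring)). assert (E2 := Hexp (- r) 0 ltac:(ring)).
  assert (E3 := Hexp 0 r ltac:(ring)). assert (E4 := Hexp 0 (- r) ltac:(ring)).
  clearbody alpha gamma. destruct alpha as [a1 a2], gamma as [g1 g2].
  unfold Re, Cmult in *. simpl fst in *. simpl snd in *.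
  assert (Hsum : r ^ 2 * beta - 8 * M ^ 5 * r ^ 3 <= 0) by lra.
  assert (Hr2 : 0 < r ^ 2) by (apply pow_lt; lra).
  nra.
Qed.

(** * Arguments and segments *)

Lemma cos_eq_mod_2PI (s t : R) :
  eq_mod_2PI s t -> cos s = cos t.
Proof.
  intros [k ->].
  destruct (Z_le_gt_dec 0 k) as [Hk|Hk].
  - rewrite <- (Z2Nat.id k Hk), <- INR_IZR_INZ.
    replace (t + INR (Z.to_nat k) * (2 * PI))
      with (t + 2 * INR (Z.to_nat k) * PI) by ring.
    apply cos_period.
  - rewrite <- (cos_period _ (Z.to_nat (- k))), INR_IZR_INZ, Z2Nat.id by lia.
    rewrite opp_IZR. f_equal. ring.
Qed.

Lemma Re_mult_polar (arg : C -> R) (h w : C) :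
  is_arg_choice arg -> h <> RtoC 0 -> w <> RtoC 0 ->
  Re (Cmult h w) = Cmod h * Cmod w * cos (arg h + arg w).
Proof.
  intros Harg Hh Hw. rewrite cos_plus.
  rewrite (Harg h Hh) at 1. rewrite (Harg w Hw) at 1.
  unfold Re, Cmult, RtoC. simpl. ring.
Qed.

Lemma Re_sqr_mult_polar (arg : C -> R) (h w : C) :
  is_arg_choice arg -> h <> RtoC 0 -> w <> RtoC 0 ->
  Re (Cmult (Cmult h h) w) = Cmod h ^ 2 * Cmod w * cos (2 * arg h + arg w).
Proof.
  intros Harg Hh Hw. rewrite cos_plus, cos_2a, sin_2a.
  rewrite (Harg h Hh) at 1 2. rewrite (Harg w Hw) at 1.
  unfold Re, Cmult, RtoC. simpl. ring.
Qed.

Lemma segment_param (z z' zeta : C) :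
  segment z z' zeta ->
  exists t : R, 0 <= t <= 1 /\
    zeta = Cplus z (Cmult (RtoC t) (Cminus z' z)).
Proof.
  intros [t [Ht ->]]. exists t. split; [exact Ht|].
  rewrite RtoC_minus. ring.
Qed.

(** Growth at every small shift [h] satisfying [P] gives growth along a short
    segment whose shifts all satisfy [P]; the bound on [eps] keeps the
    segment inside the disk where the Neumann series converges. *)
Lemma segment_growth {H : HilbertSpace} (A : operator H) (z z' : C)
  (eps : R) (P : C -> Prop) (lower : R -> R) :
  resolvent_set A z -> eps * op_norm (resolvent A z) <= 1 / 2 ->
  Cmod (Cminus z' z) <= eps ->
  (forall t, 0 <= t <= 1 -> P (Cmult (RtoC t) (Cminus z' z))) ->
  (forall h, Cmod h <= eps -> P h ->
     op_norm (resolvent A (Cplus z h)) >= lower (Cmod h)) ->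
  (forall zeta, segment z z' zeta -> resolvent_set A zeta) /\
  (forall zeta, segment z z' zeta ->
     op_norm (resolvent A zeta) >= lower (Cmod (Cminus zeta z))).
Proof.
  intros Hz Heps Hz' HP Hgrow.
  assert (Hsmall : forall t, 0 <= t <= 1 ->
            Cmod (Cmult (RtoC t) (Cminus z' z)) <= eps).
  { intros t Ht. rewrite Cmod_mult, Cmod_R, Rabs_pos_eq by lra.
    assert (H0 := Cmod_ge_0 (Cminus z' z)). nra. }
  split; intros zeta Hzeta; destruct (segment_param _ _ _ Hzeta) as [t [Ht ->]].
  - apply resolvent_set_near; [exact Hz|].
    assert (Hs := Hsmall t Ht).
    assert (HM : 0 <= op_norm (resolvent A z)) by apply op_norm_ge_0, Hz.
    nra.
  - set (h := Cmult (RtoC t) (Cminus z' z)).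
    replace (Cminus (Cplus z h) z) with h by ring.
    apply Hgrow; [now apply Hsmall | now apply HP].
Qed.

Lemma cos_2_pos (theta : R) :
  - (PI / 4) < theta < PI / 4 \/ 3 * PI / 4 < theta < 5 * PI / 4 ->
  0 < cos (2 * theta).
Proof.
  intros [Ht|Ht].
  - apply cos_gt_0; lra.
  - rewrite (cos_eq_mod_2PI (2 * theta) (2 * theta - 2 * PI)).
    + apply cos_gt_0; lra.
    + exists 1%Z. simpl. ring.
Qed.

(** * Growth of the resolvent norm at a point where it is attained *)

Theorem corollary1p3 (H : HilbertSpace) (A : operator H)
  (arg : C -> R) (arg_choice : is_arg_choice arg)
  (A_closed : closed_operator A) (A_dense : densely_defined A)
  (rho_nonempty : exists z0 : C, resolvent_set A z0)
  (z : C) (z_rho : resolvent_set A z)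
  (maximizer : exists psi : H,
     norm psi = 1 /\ norm (resolvent A z psi) = op_norm (resolvent A z)) :
  (forall U : C -> Prop,
     locally z U -> (forall zeta : C, U zeta -> resolvent_set A zeta) ->
     ~ (exists c : R, forall zeta : C, U zeta ->
          op_norm (resolvent A zeta) = c)) /\
  (let T := resolvent A z in
   exists (psi : nat -> H) (alpha : C) (beta : R) (gamma : C),
     (forall n : nat, norm (psi n) = 1) /\
     is_lim_seq (fun n => norm (T (psi n))) (op_norm T) /\
     filterlim (fun n => inner (T (psi n)) (T (T (psi n))))
       eventually (locally alpha) /\
     is_lim_seq (fun n => norm (T (T (psi n))) ^ 2) beta /\
     filterlim (fun n => inner (T (psi n)) (T (T (T (psi n)))))
       eventually (locally gamma) /\
     ((alpha <> RtoC 0 /\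
       forall theta : R, - (PI / 2) < theta < PI / 2 ->
         exists c eps0 : R, 0 < c /\ 0 < eps0 /\
           forall z' : C, z' <> z -> Cmod (z' - z) <= eps0 ->
             eq_mod_2PI (arg (z' - z)%C) (theta - arg alpha) ->
             (forall zeta : C, segment z z' zeta -> resolvent_set A zeta) /\
             (forall zeta : C, segment z z' zeta ->
                op_norm (resolvent A zeta) >=
                op_norm (resolvent A z) + c * Cmod (zeta - z)))
      \/
      (alpha = RtoC 0 /\ gamma <> RtoC 0 /\
       forall theta : R,
         - (PI / 4) < theta < PI / 4 \/ 3 * PI / 4 < theta < 5 * PI / 4 ->
         exists c eps0 : R, 0 < c /\ 0 < eps0 /\
           forall z' : C, z' <> z -> Cmod (z' - z) <= eps0 ->
             eq_mod_2PI (arg (z' - z)%C) (theta - 1 / 2 * arg gamma) ->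
             (forall zeta : C, segment z z' zeta -> resolvent_set A zeta) /\
             (forall zeta : C, segment z z' zeta ->
                op_norm (resolvent A zeta) >=
                op_norm (resolvent A z) + c * Cmod (zeta - z) ^ 2))
      \/
      (alpha = RtoC 0 /\ gamma = RtoC 0 /\ 0 < beta /\
       exists c eps0 : R, 0 < c /\ 0 < eps0 /\
         forall zeta : C, resolvent_set A zeta -> Cmod (zeta - z) <= eps0 ->
           op_norm (resolvent A zeta) >=
           op_norm (resolvent A z) + c * Cmod (zeta - z) ^ 2))).
Proof.
  destruct maximizer as [psi [Hpsi Hmax]]. split.
  { intros U HU HUrho.
    exact (resolvent_norm_not_constant A z psi U z_rho Hpsi Hmax HU HUrho). }
  intros T.
  set (alpha := inner (T psi) (T (T psi))).
  set (gamma := inner (T psi) (T (T (T psi)))).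
  exists (fun _ => psi), alpha, (vnorm (T (T psi)) ^ 2), gamma.
  split; [intros _; exact Hpsi|].
  split; [unfold T; rewrite <- Hmax; apply is_lim_seq_const|].
  split; [apply filterlim_const|].
  split; [apply is_lim_seq_const|].
  split; [apply filterlim_const|].
  assert (Hdiff : forall z' : C, z' <> z -> Cminus z' z <> RtoC 0).
  { intros z' Hz' E. apply Hz'. replace z' with (Cplus (Cminus z' z) z) by ring.
    rewrite E. ring. }
  destruct (classic (alpha = RtoC 0)) as [Ha|Ha];
    [right; destruct (classic (gamma = RtoC 0)) as [Hg|Hg]; [right|left]|left].
  - destruct (second_order_growth A z psi z_rho Hpsi Hmax Ha)
      as [c [eps [Hc [Heps [_ Hgrow]]]]].
    split; [exact Ha|]. split; [exact Hg|].
    split; [now apply pow_lt, resolvent_sqr_pos|].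
    exists c, eps. split; [exact Hc|]. split; [exact Heps|].
    intros zeta _ Hzeta.
    replace zeta with (Cplus z (Cminus zeta z)) at 1 by ring.
    apply Hgrow; [exact Hzeta|].
    cbv zeta. change (resolvent A z) with T. fold gamma.
    rewrite Hg, Cmult_0_r. simpl. lra.
  - split; [exact Ha|]. split; [exact Hg|]. intros theta Htheta.
    destruct (second_order_growth A z psi z_rho Hpsi Hmax Ha)
      as [c [eps [Hc [Heps [HeM Hgrow]]]]].
    exists c, eps. split; [exact Hc|]. split; [exact Heps|].
    intros z' Hz' Hsmall [k Hk].
    apply (segment_growth A z z' eps
      (fun h => 0 <= Re (Cmult (Cmult h h) gamma))
      (fun r => op_norm (resolvent A z) + c * r ^ 2)); auto.
    intros t Ht.
    replace (Cmult (Cmult (Cmult t (z' - z)) (Cmult t (z' - z))) gamma)%C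
      with (Cmult (RtoC (t ^ 2)) (Cmult (Cmult (z' - z) (z' - z)) gamma))%C
      by (rewrite RtoC_pow; ring).
    rewrite re_scal_l.
    rewrite (Re_sqr_mult_polar arg _ _ arg_choice (Hdiff z' Hz') Hg).
    rewrite (cos_eq_mod_2PI _ (2 * theta)).
    + assert (Hcos := cos_2_pos theta Htheta).
      apply Rmult_le_pos; [apply pow2_ge_0|].
      apply Rmult_le_pos; [|lra].
      apply Rmult_le_pos; [apply pow2_ge_0|apply Cmod_ge_0].
    + exists (2 * k)%Z. rewrite Hk, mult_IZR. field.
  - split; [exact Ha|]. intros theta Htheta.
    assert (Hcos : 0 < cos theta) by (apply cos_gt_0; lra).
    assert (Hmod : 0 < Cmod alpha) by now apply Cmod_gt_0.
    destruct (first_order_growth A z psi (Cmod alpha * cos theta)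
                z_rho Hpsi Hmax) as [c [eps [Hc [Heps [HeM Hgrow]]]]].
    { now apply Rmult_lt_0_compat. }
    exists c, eps. split; [exact Hc|]. split; [exact Heps|].
    intros z' Hz' Hsmall [k Hk].
    apply (segment_growth A z z' eps
      (fun h => Cmod alpha * cos theta * Cmod h <= Re (Cmult h alpha))
      (fun r => op_norm (resolvent A z) + c * r)); auto.
    intros t Ht.
    rewrite <- Cmult_assoc, re_scal_l, Cmod_mult, Cmod_R, Rabs_pos_eq by lra.
    rewrite (Re_mult_polar arg _ _ arg_choice (Hdiff z' Hz') Ha).
    replace (cos (arg (z' - z)%C + arg alpha)) with (cos theta); [right; ring|].
    symmetry. apply cos_eq_mod_2PI. exists k. rewrite Hk. ring.
Qed.
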